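(* Let $n\ge 2$ and $m>n$. Consider the following ordinal algorithm for $n$ agents and $m$ goods: going through agents $1,\dots,n-1$ in this order, each agent receives exactly one good, namely the good ranked highest in her preference ranking among the goods that have not been allocated yet; then agent $n$ receives all the remaining goods. For every profile of additive valuations $(v_i)_{i\in N}$ and every profile of rankings $(\succ_i)_{i\in N}$ consistent with it, the allocation computed by this algorithm on input $(\succ_i)_{i\in N}$ is $\frac{1}{m-n}$-EFX.
   Context: There is a set $N=\{1,\dots,n\}$ of $n\ge 2$ agents and a set $G$ of $m$ goods. Each agent $i$ has a valuation function $v_i:G\to\mathbb{R}_{\ge 0}$, extended additively to bundles: $v_i(X)=\sum_{g\in X}v_i(g)$ for $X\subseteq G$. An allocation is a tuple $(X_i)_{i\in N}$ of pairwise disjoint (possibly empty) bundles with $\bigcup_{i}X_i=G$. For $\alpha\in[0,1]$, an allocation is $\alpha$-EFX if for all agents $i\ne j$ with $X_j\neq\varnothing$ and every $g\in X_j$, $v_i(X_i)\ge\alpha\cdot v_i(X_j\setminus\{g\})$. A ranking (strict linear order) $\succ_i$ of $G$ is consistent with $v_i$ if $g\succ_i g'$ implies $v_i(g)\ge v_i(g')$. An ordinal algorithm receives as input only the rankings $(\succ_i)_{i\in N}$, consistent with the unknown valuations, and outputs an allocation. *)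

(* Defs.v *)
From mathcomp Require Import all_boot all_order all_algebra.
From mathcomp Require Import reals.

Set Implicit Arguments.
Unset Strict Implicit.
Unset Printing Implicit Defensive.

Import Order.TTheory GRing.Theory Num.Theory.

Local Open Scope ring_scope.

(* Agents 1, ..., n are represented by the ordinals 0, ..., n.-1. *)

Definition bundle_value (R : realType) (G : finType) (v : G -> R)
    (A : {set G}) : R := \sum_(g in A) v g.

Definition is_allocation (n : nat) (G : finType)
    (X : {ffun 'I_n -> {set G}}) : Prop :=
  (forall i j : 'I_n, i != j -> [disjoint X i & X j]) /\
  \bigcup_(i < n) X i = [set: G].

Definition is_EFX (R : realType) (n : nat) (G : finType) (alpha : R)
    (v : 'I_n -> G -> R) (X : {ffun 'I_n -> {set G}}) : Prop :=
  forall i j : 'I_n, i != j -> X j != set0 ->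
  forall g : G, g \in X j ->
    alpha * bundle_value (v i) (X j :\ g) <= bundle_value (v i) (X i).

(* [r g h] means that [g] is ranked strictly above [h]. *)
Definition is_ranking (G : finType) (r : rel G) : Prop :=
  [/\ irreflexive r, transitive r & forall g h : G, g != h -> r g h || r h g].

Definition consistent (R : realType) (G : finType) (r : rel G)
    (v : G -> R) : Prop :=
  forall g h : G, r g h -> v h <= v g.

Definition top_good (G : finType) (r : rel G) (A : {set G}) : option G :=
  [pick g in A | [forall h in A, (h != g) ==> r g h]].

(* A state is the set of goods still unallocated and the current bundles. For
   rankings, [None] only occurs when no good is left. *)
Definition pick_step (n : nat) (G : finType) (rk : 'I_n -> rel G)
    (st : {set G} * {ffun 'I_n -> {set G}}) (i : 'I_n) :
    {set G} * {ffun 'I_n -> {set G}} :=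
  if top_good (rk i) st.1 is Some g then
    (st.1 :\ g, [ffun j => if j == i then [set g] else st.2 j])
  else st.

(* [enum 'I_n] is increasing, and [i.+1 < n] excludes only the last agent. *)
Definition picking_algorithm (n : nat) (G : finType) (rk : 'I_n -> rel G) :
    {ffun 'I_n -> {set G}} :=
  let st := foldl (pick_step rk) ([set: G], [ffun=> set0])
                  [seq i : 'I_n <- enum 'I_n | (i.+1 < n)%N] in
  [ffun j : 'I_n => if j.+1 == n then st.1 else st.2 j].

(* Main.v *)
Require Import Defs.
From mathcomp Require Import all_boot all_order all_algebra.
From mathcomp Require Import reals.

(* An agent i < n picks a good g she ranks above everything still available,
   hence above each good of the last agent's bundle. That bundle has m - n + 1
   goods, so without one of them it is worth at most (m - n) v_i(g) to her;
   every other bundle is a singleton, which nobody envies after a removal. *)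

Set Implicit Arguments.
Unset Strict Implicit.
Unset Printing Implicit Defensive.

Import Order.TTheory GRing.Theory Num.Theory.

Local Open Scope ring_scope.

Lemma top_goodP (G : finType) (r : rel G) (A : {set G}) :
  is_ranking r -> A != set0 ->
  exists g, [/\ top_good r A = Some g, g \in A &
    {in A, forall h, h != g -> r g h}].
Proof.
move=> [r_irr r_tr r_tot] /set0Pn[g0 g0A].
rewrite /top_good; case: pickP => [g /andP[gA /forall_inP top_g] | no_top].
  by exists g; split=> // h hA; apply/implyP/top_g.
(* A top good is a [g] in [A] ranked above the largest number of goods. If some [h] in [A] were
   above [g], transitivity would put [h] above all these goods, and above [g] as well, hence above
   strictly more. *)
have [g gA g_max] := arg_maxnP (fun g => #|[set k | r g k]|) g0A.
have /negP[] := negbT (no_top g); rewrite [g \in A]gA /=.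
apply/forall_inP => h hA; apply/implyP=> h_neq_g.
have /orP[r_hg|//] := r_tot _ _ h_neq_g.
apply: contraTT (g_max h hA) => _; rewrite /= -ltnNge.
apply/proper_card/properP; split.
  by apply/subsetP=> k; rewrite !inE; apply: r_tr.
by exists g; rewrite inE ?r_irr.
Qed.

(** Loop invariant of the picking phase. Picks remain best as the pool only shrinks: a good
    preferred to all those available at its pick stays preferred to those left later. The count
    gives the size of the last bundle; the disjointness and covering clauses make the output an
    allocation. *)
Lemma foldl_pick_step (n : nat) (G : finType) (rk : 'I_n -> rel G)
    (s : seq 'I_n) :
  (forall i, is_ranking (rk i)) -> uniq s -> (size s <= #|G|)%N ->
  let st := foldl (pick_step rk) ([set: G], [ffun=> set0]) s in
  [/\ (#|st.1| + size s)%N = #|G|,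
      forall i, if i \in s then
        exists2 g, st.2 i = [set g] & {in st.1, forall h, rk i g h}
        else st.2 i = set0,
      forall i, [disjoint st.2 i & st.1],
      forall i j, i != j -> [disjoint st.2 i & st.2 j] &
      forall g, g \notin st.1 -> exists2 i, i \in s & g \in st.2 i].
Proof.
move=> rk_ranking; elim/last_ind: s => [|s k IHs].
  move=> _ _ /=; split.
  - by rewrite addn0 cardsT.
  - by move=> i; rewrite ffunE.
  - by move=> i; rewrite ffunE -setI_eq0 set0I.
  - by move=> i j _; rewrite !ffunE -setI_eq0 set0I.
  - by move=> g; rewrite inE.
rewrite rcons_uniq size_rcons => /andP[k_notin_s s_uniq] lt_s.
rewrite foldl_rcons; move: (IHs s_uniq (ltnW lt_s)).
case: (foldl _ _ s) => A X /= [card_A X_s X_A X_X X_cover].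
(* Fewer picks than goods have been made, so the pool is nonempty and the [None] branch of
   [pick_step] cannot occur. *)
have A_neq0 : A != set0.
  by rewrite -card_gt0 -(ltn_add2r (size s)) card_A.
have [g [top_g gA g_max]] := top_goodP (rk_ranking k) A_neq0.
have X_g i : g \notin X i by apply: contraTN gA => /(disjointFr (X_A i)) ->.
rewrite /pick_step top_g /=; split.
- by rewrite addnS -addSn -[_.+1]add1n -card_A (cardsD1 g A) gA.
- move=> i; rewrite ffunE mem_rcons in_cons; case: eqP => [-> | _] /=.
    by exists g => // h /setD1P[h_neq_g hA]; apply: g_max.
  have := X_s i; case: ifP => // _ [h X_i h_max]; exists h => // h'.
  by case/setD1P=> _; apply: h_max.
- move=> i; rewrite ffunE; case: eqP => _.
    by rewrite disjoints1 !inE eqxx.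
  exact: disjointWr (subD1set _ _) (X_A i).
- move=> i j i_neq_j; rewrite !ffunE; case: eqP => [ik | _].
    by rewrite -ik eq_sym (negPf i_neq_j) disjoints1.
  case: eqP => _; last exact: X_X.
  by rewrite disjoint_sym disjoints1.
- move=> h; rewrite !inE negb_and negbK => /orP[/eqP-> | h_notin_A].
    by exists k; rewrite ?mem_rcons ?mem_head // ffunE eqxx inE.
  have [i i_s h_Xi] := X_cover h h_notin_A.
  exists i; first by rewrite mem_rcons in_cons i_s orbT.
  (* The update at [k] overwrites no earlier pick, since [k] does not occur in [s]. *)
  by rewrite ffunE; case: eqP => // ik; rewrite -ik i_s in k_notin_s.
Qed.

Lemma size_but_last (n : nat) :
  size [seq i : 'I_n <- enum 'I_n | (i.+1 < n)%N] = n.-1.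
Proof.
case: n => [|n]; first by rewrite (size0nil (size_enum_ord 0)).
transitivity #|predC1 (@ord_max n)|; last by rewrite cardC1 card_ord.
rewrite cardE enumT; congr size; apply: eq_filter => i.
by rewrite !inE -val_eqE /= ltnS ltn_neqAle -ltnS ltn_ord andbT.
Qed.

Lemma bundle_value_le_card (R : realType) (G : finType) (v : G -> R)
    (A : {set G}) (c : R) :
  {in A, forall g, v g <= c} -> bundle_value v A <= #|A|%:R * c.
Proof. by move=> v_le; rewrite mulr_natl -sumr_const; apply: ler_sum. Qed.

Theorem theorem2p1 (R : realType) (n m : nat) (G : finType)
    (n_ge2 : (2 <= n)%N) (card_G : #|G| = m) (m_gt_n : (n < m)%N)
    (v : 'I_n -> G -> R) (v_ge0 : forall (i : 'I_n) (g : G), 0 <= v i g)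
    (rk : 'I_n -> rel G) (rk_ranking : forall i : 'I_n, is_ranking (rk i))
    (rk_consistent : forall i : 'I_n, consistent (rk i) (v i)) :
  is_allocation (picking_algorithm rk) /\
  is_EFX (1 / (m%:R - n%:R)) v (picking_algorithm rk).
Proof.
rewrite /picking_algorithm; set s := filter _ _.
have size_s : size s = n.-1 := size_but_last n.
have s_uniq : uniq s by rewrite filter_uniq // enum_uniq.
(* Since [i.+1 <= n] for every ordinal [i], the filter's strict inequality is the negation of the
   test [i.+1 == n] that selects the last agent in the output. *)
have mem_s i : (i \in s) = (i.+1 != n).
  by rewrite mem_filter mem_enum andbT ltn_neqAle ltn_ord andbT.
have size_s_le : (size s <= #|G|)%N.
  by rewrite size_s card_G (leq_trans (leq_pred n)) // ltnW.
have := foldl_pick_step rk_ranking s_uniq size_s_le.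
case: (foldl _ _ s) => A X /= [card_A X_s X_A X_X X_cover].
have last_uniq (i j : 'I_n) : i.+1 == n -> j.+1 == n -> i = j.
  by move=> /eqP i_last /eqP j_last; apply/val_inj/succn_inj; rewrite i_last.
split; first split.
- move=> i j i_neq_j; rewrite !ffunE.
  case: ifP => i_last; case: ifP => j_last.
  + by rewrite (last_uniq i j) // eqxx in i_neq_j.
  + by rewrite disjoint_sym.
  + exact: X_A.
  + exact: X_X.
- apply/setP=> g; rewrite inE; apply/bigcupP.
  have [gA | /X_cover[i i_s g_Xi]] := boolP (g \in A); last first.
    by exists i => //; rewrite ffunE; move: i_s; rewrite mem_s => /negPf->.
  have last_lt : (n.-1 < n)%N by rewrite prednK // ltnW.
  by exists (Ordinal last_lt); rewrite // ffunE /= prednK ?eqxx // ltnW.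
move=> i j i_neq_j _ g; rewrite !ffunE.
have mn_gt0 : 0 < m%:R - n%:R :> R by rewrite subr_gt0 ltr_nat.
case: ifP => [j_last | j_nlast] g_Xj; last first.
  have := X_s j; rewrite mem_s j_nlast /= => -[h X_j _].
  move: g_Xj; rewrite X_j => /set1P->; rewrite setDv.
  by rewrite [X in _ * X]/bundle_value big_set0 mulr0 sumr_ge0.
(* The envied bundle is now the leftover pool [A], so the envious agent is one of those who
   picked. *)
have i_nlast : i.+1 == n = false.
  by apply/negP=> i_last; rewrite (last_uniq i j) // eqxx in i_neq_j.
rewrite i_nlast; have := X_s i; rewrite mem_s i_nlast /= => -[h -> h_max].
have -> : bundle_value (v i) [set h] = v i h by rewrite /bundle_value big_set1.
have card_Ag : #|A :\ g|%:R = m%:R - n%:R :> R.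
  rewrite -natrB ?(ltnW m_gt_n) //; congr _%:R.
  move: card_A; rewrite size_s card_G (cardsD1 g A) g_Xj => <-.
  by rewrite add1n addSnnS prednK ?addnK // ltnW.
(* Clearing the positive denominator and reading [m - n] as the size of [A :\ g] leaves the bound of
   a sum by its number of terms times [v i h]. *)
rewrite mul1r mulrC ler_pdivrMr // mulrC -card_Ag.
apply: bundle_value_le_card => k /setD1P[_ kA].
exact/rk_consistent/h_max.
Qed.
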